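(* Let $\Gamma$ be a finite, simple, connected graph having no singleton twin. Then $\Gamma$ has the exchange property (for resolving sets).
   Context: For vertices $u,v$ of a finite, simple, connected graph $\Gamma$ with vertex set $V(\Gamma)$, $d_\Gamma(u,v)$ is the length of a shortest path between $u$ and $v$. The open neighborhood is $N(u)=\{v\in V(\Gamma): d_\Gamma(u,v)=1\}$ and the closed neighborhood is $N[u]=N(u)\cup\{u\}$. Vertices $u,v$ are called twins, written $u\equiv v$, if $N[u]=N[v]$ or $N(u)=N(v)$; this is an equivalence relation on $V(\Gamma)$, and $\overline{u}$ denotes the twin class of $u$. A vertex $u$ is called a singleton twin if $\overline{u}=\{u\}$. A set $W=\{w_1,\dots,w_k\}\subseteq V(\Gamma)$ is a resolving set if distinct vertices $v$ of $\Gamma$ have distinct representations $(d_\Gamma(v,w_1),\dots,d_\Gamma(v,w_k))$. A resolving set is minimal if it contains no resolving set as a proper subset. The graph $\Gamma$ has the exchange property (for resolving sets) if, whenever $W_1$ and $W_2$ are minimal resolving sets of $\Gamma$, for every $u\in W_1$ there is a vertex $v\in W_2$ such that $(W_1\setminus\{u\})\cup\{v\}$ is also a minimal resolving set. *)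

(* Defs.v *)
From mathcomp Require Import all_boot.

Set Implicit Arguments.
Unset Strict Implicit.
Unset Printing Implicit Defensive.

Section Graph.

Variables (T : finType) (e : rel T).

Definition simple_graph : Prop := symmetric e /\ irreflexive e.

(* The graph with no vertices satisfies this predicate. *)
Definition connected : Prop := forall u v : T, connect e u v.

Definition has_path (u v : T) (n : nat) : bool :=
  [exists p : n.-tuple T, [&& path e u p, uniq (u :: p) & last u p == v]].

(* Paths have distinct vertices, hence length less than #|T|. The value is
   the junk #|T| when u and v lie in distinct components; [distP] covers the
   connected case. *)
Definition dist (u v : T) : nat := find (has_path u v) (iota 0 #|T|).

Definition open_nbhd (u : T) : {set T} := [set v | dist u v == 1].

Definition closed_nbhd (u : T) : {set T} := open_nbhd u :|: [set u].

Definition twins (u v : T) : bool :=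
  (closed_nbhd u == closed_nbhd v) || (open_nbhd u == open_nbhd v).

Definition twin_class (u : T) : {set T} := [set v | twins u v].

Definition singleton_twin (u : T) : bool := twin_class u == [set u].

Definition representation (W : {set T}) (v : T) : seq nat :=
  [seq dist v w | w <- enum W].

Definition resolving (W : {set T}) : bool := injectiveb (representation W).

Definition minimal_resolving (W : {set T}) : bool := minset resolving W.

Definition exchange_property : Prop :=
  forall W1 W2 : {set T}, minimal_resolving W1 -> minimal_resolving W2 ->
  forall u : T, u \in W1 ->
  exists2 v : T, v \in W2 & minimal_resolving ((W1 :\ u) :|: [set v]).

Lemma distP (u v : T) : connect e u v ->
  (exists p : seq T, [/\ path e u p, last u p = v & size p = dist u v]) /\
  (forall p : seq T, path e u p -> last u p = v -> dist u v <= size p).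
Proof.
move=> /connectP[p0 ep0 lp0].
have bnd p : path e u p -> last u p = v ->
    exists n, [/\ n <= size p, n < #|T| & has_path u v n].
  move=> ep lp; case/shortenP: ep lp => q eq uq sq lq.
  exists (size q); split.
  - by case/andP: uq => _ uq; exact: uniq_leq_size.
  - by have := max_card (mem (u :: q)); rewrite (card_uniqP uq).
  - by apply/existsP; exists (in_tuple q); rewrite /= lq eqxx eq andbT.
have dist_le n : n < #|T| -> has_path u v n -> dist u v <= n.
  move=> nT hn; rewrite leqNgt; apply/negP => lt_n.
  by have := before_find 0 lt_n; rewrite nth_iota // add0n hn.
split; last first.
  move=> p ep lp; have [n [le_n nT hn]] := bnd p ep lp.
  exact: leq_trans (dist_le n nT hn) le_n.
have [n [_ nT hn]] := bnd p0 ep0 (esym lp0).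
have hasd : has (has_path u v) (iota 0 #|T|).
  by apply/hasP; exists n; rewrite // mem_iota.
have := nth_find 0 hasd; rewrite -/(dist u v) nth_iota ?add0n; last first.
  exact: leq_ltn_trans (dist_le n nT hn) nT.
case/existsP=> q /and3P[eq _ /eqP lq].
by exists q; rewrite size_tuple.
Qed.

End Graph.

(* Main.v *)
Require Import Defs.
From mathcomp Require Import all_boot.

(** Swapping two twins is a symmetry of the graph, so twins are equidistant from
    every third vertex, and a resolving set omits at most one vertex of each twin
    class ([resolving_omits_no_twins]).  When every class has at least two
    vertices the converse holds ([resolvingP]): such a set [W] then meets every
    class, and membership of a vertex [w] in a neighborhood depends only on the
    class of [w]; two vertices outside [W] with the same representation are
    adjacent to the same members of [W], hence to the same third vertices, and
    so they are twins.

    Minimal resolving sets are thus the complements of the transversals of the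
    partition into twin classes ([minimal_resolvingP]).  Replacing [u] by the
    vertex [v] of its class that [W1] omits gives again such a complement; and
    [W2] contains [u] or [v], so one of [(W1 :\ u) :|: [set v]] and
    [(W1 :\ u) :|: [set u] = W1] is the exchange required. *)

Set Implicit Arguments.
Unset Strict Implicit.
Unset Printing Implicit Defensive.

Section TwinsAndResolvingSets.

Variables (T : finType) (e : rel T).
Hypotheses (simple_e : simple_graph e) (conn_e : connected e).

Let e_sym : symmetric e. Proof. by case: simple_e. Qed.
Let e_irr : irreflexive e. Proof. by case: simple_e. Qed.

Lemma dist_refl u : dist e u u = 0.
Proof.
have [_ dist_le] := distP (conn_e u u).
by apply/eqP; rewrite -leqn0; exact: (dist_le [::]).
Qed.

Lemma dist_eq0 u v : (dist e u v == 0) = (u == v).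
Proof.
apply/eqP/eqP => [d0 | ->]; last exact: dist_refl.
have [[p [_ lp sp]] _] := distP (conn_e u v).
by move: sp lp; rewrite d0 => /size0nil ->.
Qed.

Lemma dist_eq1 u v : (dist e u v == 1) = e u v.
Proof.
have [[p [ep lp sp]] dist_le] := distP (conn_e u v).
apply/eqP/idP => [d1 | euv].
  by case: p ep lp sp => [|a [|b p]] //=; rewrite d1 // andbT => eua <-.
have := dist_le [:: v]; rewrite /= euv => /(_ isT erefl).
rewrite leq_eqVlt ltnS leqn0 dist_eq0 => /orP[/eqP // | /eqP uv].
by rewrite uv e_irr in euv.
Qed.

(** This form makes no distinction between adjacent and non-adjacent twins. *)
Lemma twinsP u v :
  reflect (forall w, w != u -> w != v -> e u w = e v w) (twins e u v).
Proof.
have in_open x w : (w \in open_nbhd e x) = e x w by rewrite inE dist_eq1.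
have in_closed x w : (w \in closed_nbhd e x) = e x w || (w == x).
  by rewrite in_setU in_open in_set1.
apply: (iffP orP) => [[] /eqP/setP nbhd_uv w wu wv | adj_uv].
- by have := nbhd_uv w; rewrite !in_closed (negPf wu) (negPf wv) !orbF.
- by have := nbhd_uv w; rewrite !in_open.
case euv: (e u v); [left | right]; apply/eqP/setP => w.
  rewrite !in_closed; have [-> | wu] := eqVneq w u.
    by rewrite orbT e_sym euv.
  by have [-> | wv] := eqVneq w v; rewrite ?euv ?orbT // !orbF adj_uv.
rewrite !in_open; have [-> | wu] := eqVneq w u; first by rewrite e_irr e_sym.
by have [-> | wv] := eqVneq w v; [rewrite euv e_irr | exact: adj_uv].
Qed.

Lemma twins_sym : symmetric (twins e).
Proof. by move=> u v; rewrite /twins eq_sym [X in _ || X]eq_sym. Qed.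

(** The only delicate vertex is the middle one [v]: the values [e u v], [e u w]
    and [e v w] all agree, whichever kinds of twins are involved. *)
Lemma twins_trans : transitive (twins e).
Proof.
move=> v u w /twinsP uv /twinsP vw; apply/twinsP => z zu zw.
have [zv | zv] := eqVneq z v; last by rewrite uv // vw.
rewrite {z}zv in zu zw *; have [-> // | wu] := eqVneq w u.
rewrite (e_sym u v) vw 1?eq_sym // e_sym uv 1?eq_sym //.
by rewrite eq_sym.
Qed.

(** The first step of a shortest path from [v] either is [u], and then [u] is
    closer to [w], or can be taken from [u] as well. *)
Lemma twins_dist_le u v w : twins e u v -> w != v -> dist e u w <= dist e v w.
Proof.
move=> /twinsP uv wv.
have [[p [ep lp <-]] _] := distP (conn_e v w).
have [_ dist_le] := distP (conn_e u w).
case: p ep lp => [_ /= vw | a p /= /andP[eva ep] lp]; first by rewrite vw eqxx in wv.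
have [au | au] := eqVneq a u.
  by rewrite au in ep lp; exact: leq_trans (dist_le p ep lp) (leqnSn _).
apply: (dist_le (a :: p)) => //=; rewrite ep andbT uv //.
by apply: contraTneq eva => ->; rewrite e_irr.
Qed.

Lemma twins_dist u v w :
  twins e u v -> w != u -> w != v -> dist e u w = dist e v w.
Proof.
move=> uv wu wv; apply/eqP.
by rewrite eqn_leq !twins_dist_le // twins_sym.
Qed.

Lemma eq_representationP (W : {set T}) x y :
  reflect {in W, forall w, dist e x w = dist e y w}
          (representation e W x == representation e W y).
Proof.
apply: (iffP eqP) => [/eq_in_map eq_d w Ww | eq_d].
  by apply: eq_d; rewrite mem_enum.
by apply/eq_in_map => w; rewrite mem_enum; exact: eq_d.
Qed.

Definition omits_no_twins (W : {set T}) :=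
  forall u v, u \notin W -> v \notin W -> twins e u v -> u = v.

Lemma resolving_omits_no_twins W : resolving e W -> omits_no_twins W.
Proof.
move=> /injectiveP inj_rep u v uW vW uv; apply: inj_rep.
apply/eqP/eq_representationP => w Ww.
by apply: twins_dist => //; apply: contraTneq Ww => ->.
Qed.

Hypothesis no_singleton : forall u, ~~ singleton_twin e u.

Lemma exists_twin u : exists2 v, v != u & twins e u v.
Proof.
have class_u : [set u] \subset twin_class e u.
  by rewrite sub1set inE /twins eqxx.
have := no_singleton u; rewrite /singleton_twin eqEsubset class_u andbT.
by case/subsetPn => v; rewrite !inE => uv vu; exists v.
Qed.

Lemma resolvingP W : reflect (omits_no_twins W) (resolving e W).
Proof.
apply: (iffP idP) => [|omitW]; first exact: resolving_omits_no_twins.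
apply/injectiveP => x y /eqP/eq_representationP eq_d.
have [xW | xW] := boolP (x \in W).
  by apply/esym/eqP; rewrite -dist_eq0 -eq_d // dist_refl.
have [yW | yW] := boolP (y \in W).
  by apply/eqP; rewrite -dist_eq0 eq_d // dist_refl.
apply: (omitW) => //; apply/twinsP => w wx wy.
have adjW z : z \in W -> e x z = e y z by move=> Wz; rewrite -!dist_eq1 eq_d.
have [/adjW // | wW] := boolP (w \in W).
(* A twin of [w] lies in [W] and stands in for it. *)
have [z zw wz] := exists_twin w.
have zW : z \in W by apply: contraR zw => zW; rewrite (omitW w z).
have adj_wz t : t \notin W -> w != t -> e t w = e t z.
  move=> tW wt; rewrite e_sym (e_sym t); move/twinsP: wz; apply.
    by rewrite eq_sym.
  by apply: contraNneq tW => ->.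
by rewrite !adj_wz // adjW.
Qed.

(** The two conditions together say that the complement of [W] contains exactly
    one vertex of each twin class. *)
Lemma minimal_resolvingP W :
  reflect (omits_no_twins W /\
           {in W, forall u, exists2 v, v \notin W & twins e u v})
          (minimal_resolving e W).
Proof.
apply: (iffP minsetP) => [[/resolvingP omitW minW] | [omitW twinW]]; split=> //.
- move=> u Wu; have [/exists_inP //| noV] := boolP [exists (v | v \notin W), twins e u v].
  have no_twin v : v \notin W -> ~~ twins e u v.
    by move=> vW; apply: contraNN noV => uv; apply/exists_inP; exists v.
  have resWu : resolving e (W :\ u).
    apply/resolvingP => x y; rewrite !in_setD1 !negb_and !negbK.
    move=> /orP[/eqP-> | xW] /orP[/eqP-> | yW] //; last exact: omitW.
      by rewrite (negPf (no_twin y yW)).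
    by rewrite twins_sym (negPf (no_twin x xW)).
  have := minW _ resWu (subsetDl _ _) => /setP/(_ u).
  by rewrite in_setD1 eqxx Wu.
- exact/resolvingP.
move=> Z /resolvingP omitZ ZW; apply/eqP; rewrite eqEsubset ZW /=.
apply/subsetP => w Ww; apply: contraT => wZ.
have [v vW wv] := twinW w Ww.
have vZ : v \notin Z by apply: contraNN vW => /(subsetP ZW).
by rewrite -(omitZ w v wZ vZ wv) Ww in vW.
Qed.

Lemma minimal_resolving_swap W u v :
  minimal_resolving e W -> u \in W -> v \notin W -> twins e u v ->
  minimal_resolving e ((W :\ u) :|: [set v]).
Proof.
move=> /minimal_resolvingP[omitW twinW] Wu vW uv.
have memS x : x \in (W :\ u) :|: [set v] = (x != u) && (x \in W) || (x == v).
  by rewrite in_setU in_setD1 in_set1.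
have neq_uv : u != v by apply: contraNneq vW => <-.
have uS : u \notin (W :\ u) :|: [set v] by rewrite memS eqxx.
(* Another omitted twin of [u] would be a second vertex of its class, besides
   [v], that [W] omits. *)
have only_u y : y \notin (W :\ u) :|: [set v] -> twins e u y -> y = u.
  rewrite memS => yS uy; apply/eqP; apply: contraNT yS => yu.
  rewrite yu /=; apply: contraT; rewrite negb_or => /andP[yW] /eqP[].
  by apply: omitW => //; apply: twins_trans uv; rewrite twins_sym.
apply/minimal_resolvingP; split=> [x y xS yS xy | w].
  have [xu | xu] := eqVneq x u; first by rewrite xu in xy *; rewrite (only_u y).
  have [yu | yu] := eqVneq y u.
    by rewrite yu in xy *; apply: only_u; rewrite // twins_sym.
  move: xS yS; rewrite !memS xu yu !negb_or => /andP[xW _] /andP[yW _].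
  exact: omitW.
rewrite memS => /orP[/andP[wu Ww] | /eqP->]; last by exists u; rewrite 1?twins_sym.
have [z zW wz] := twinW w Ww.
have [zv | zv] := eqVneq z v.
  by exists u => //; apply: twins_trans wz _; rewrite zv twins_sym.
by exists z; rewrite // memS (negPf zW) (negPf zv) andbF.
Qed.

End TwinsAndResolvingSets.

Theorem theorem1p3 (T : finType) (e : rel T) (simple_e : simple_graph e)
    (conn_e : connected e) (no_singleton : forall u : T, ~~ singleton_twin e u) :
  exchange_property e.
Proof.
move=> W1 W2 min1 min2 u W1u.
have [_ /(_ u W1u)[v vW1 uv]] :=
  minimal_resolvingP simple_e conn_e no_singleton W1 min1.
have [W2v | vW2] := boolP (v \in W2).
  by exists v => //; apply: minimal_resolving_swap.
exists u; last by rewrite setUC setD1K.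
have [omit2 _] := minimal_resolvingP simple_e conn_e no_singleton W2 min2.
apply: contraT => uW2; move: vW1.
by rewrite -(omit2 u v uW2 vW2 uv) W1u.
Qed.
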